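(* Let $q$ be a prime power and $e$ a positive integer with $\gcd(e,q)=1$; set $k=\mathrm{ord}_e q$ and $l=\varphi(e)/k$. Let $n$ be a positive integer such that every prime divisor of $n$ divides $q-1$, $\gcd(n,ke)=1$, and $q\equiv1\pmod 4$ if $8$ divides $n$. Let $d=\gcd(n,q-1)$, $m=n/d$, and let $\theta\in\mathbb F_q$ be any element of multiplicative order $d$. If $\Phi_e(x)=\prod_{i=1}^{l}f_i(x)$ is the factorization of the $e$-th cyclotomic polynomial into monic irreducible polynomials over $\mathbb F_q$, then the factorization of $\Phi_e(x^n)$ into irreducible polynomials over $\mathbb F_q$ is $$\Phi_e(x^n)=\prod_{i=1}^{l}\prod_{t\mid m}\ \prod_{\substack{1\le u\le d\\ \gcd(u,t)=1}}\theta^{-uk}f_i(\theta^{u}x^{t}).$$ Moreover, if $x^e-1=\prod_{i=1}^{N}F_i(x)$ is the factorization of $x^e-1$ into monic irreducible polynomials over $\mathbb F_q$, then the factorization of $x^{en}-1$ into irreducible polynomials over $\mathbb F_q$ is $$x^{en}-1=\prod_{i=1}^{N}\prod_{t\mid m}\ \prod_{\substack{1\le u\le d\\ \gcd(u,t)=1}}\theta^{-u\deg(F_i)}F_i(\theta^{u}x^{t}).$$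
   Context: $\mathrm{ord}_e q$ is the multiplicative order of $q$ modulo $e$, $\varphi$ is Euler's totient function, and $\Phi_e(x)\in\mathbb F_q[x]$ is the $e$-th cyclotomic polynomial, defined recursively by $x^e-1=\prod_{j\mid e}\Phi_j(x)$. *)

(* Defs.v *)
From mathcomp Require Import all_boot all_order all_algebra all_fingroup.
From mathcomp Require Import all_solvable all_field.

Set Implicit Arguments.
Unset Strict Implicit.
Unset Printing Implicit Defensive.

Import GRing.Theory.
Local Open Scope ring_scope.

(* The least k > 0 with a ^ k = 1 %[mod e]. When e > 0 is coprime to a, such a
   k exists among 1, ..., e, so searching that range suffices; otherwise the
   value is junk. Unlike #[_] in {unit 'Z_e}, this is also correct for e = 1. *)
Definition ord_mod (e a : nat) : nat :=
  (find (fun k => a ^ k.+1 == 1 %[mod e]) (iota 0 e)).+1%N.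

Lemma ord_mod_gt0 e a : (0 < ord_mod e a)%N.
Proof. by []. Qed.

Lemma ord_mod_has e a : (0 < e)%N -> coprime e a ->
  has (fun k => a ^ k.+1 == 1 %[mod e])%N (iota 0 e).
Proof.
move=> e_gt0 co_ea; apply/hasP; exists (totient e).-1.
  rewrite mem_iota add0n /= prednK ?totient_gt0 // totient_count_coprime.
  rewrite (leq_trans (leq_sum _ (E2 := fun _ => 1%N) _)) //.
    by move=> i _; case: coprime.
  by rewrite sum_nat_const_nat subn0 muln1.
by rewrite prednK ?totient_gt0 //; apply/eqP/Euler_exp_totient; rewrite coprime_sym.
Qed.

Lemma expn_ord_mod e a : (0 < e)%N -> coprime e a ->
  (a ^ ord_mod e a = 1 %[mod e])%N.
Proof.
move=> e_gt0 co_ea; have has_k := ord_mod_has e_gt0 co_ea.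
apply/eqP; have := nth_find 0%N has_k.
by rewrite nth_iota ?add0n // -[X in (_ < X)%N](size_iota 0) -has_find.
Qed.

Lemma ord_mod_min e a k : (0 < e)%N -> coprime e a -> (0 < k)%N ->
  (a ^ k = 1 %[mod e])%N -> (ord_mod e a <= k)%N.
Proof.
case: k => // k e_gt0 co_ea _ ak1; rewrite /ord_mod ltnS leqNgt.
apply/negP => lt_k; have := before_find 0%N lt_k; rewrite nth_iota ?add0n.
  by rewrite ak1 eqxx.
by apply: leq_trans lt_k _; rewrite -[X in (_ <= X)%N](size_iota 0) find_size.
Qed.

(* The e-th cyclotomic polynomial over F is the image of the integral one;
   cycl_prod and cycl_unique show that this agrees with the recursive
   definition by x^e - 1 = \prod_(j | e) Phi_j(x) over F itself. *)
Definition cycl (F : nzRingType) (e : nat) : {poly F} := map_poly intr 'Phi_e.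

Lemma cycl_monic (F : nzRingType) e : cycl F e \is monic.
Proof. by rewrite monic_map // Cyclotomic_monic. Qed.

Lemma cycl_prod (F : nzRingType) e : (0 < e)%N ->
  'X^e - 1 = \prod_(j <- divisors e) cycl F j.
Proof.
move=> e_gt0; rewrite -rmorph_prod /= prod_Cyclotomic //.
by rewrite rmorphB rmorph1 /= map_polyXn.
Qed.

Lemma cycl_unique (F : idomainType) (P : nat -> {poly F}) :
    (forall e, (0 < e)%N -> 'X^e - 1 = \prod_(j <- divisors e) P j) ->
  forall e, (0 < e)%N -> P e = cycl F e.
Proof.
move=> prodP e; have [b] := ubnP e; elim: b e => // b IHb e /ltnSE le_eb e_gt0.
have e_div : e \in divisors e by rewrite -dvdn_divisors.
have eq_rem : \prod_(j <- rem e (divisors e)) P j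
            = \prod_(j <- rem e (divisors e)) cycl F j.
  apply: eq_big_seq => j; rewrite (mem_rem_uniq _ (divisors_uniq e)) inE /=.
  case/andP=> ne_je; rewrite -dvdn_divisors // => j_dv_e.
  apply: IHb (dvdn_gt0 e_gt0 j_dv_e); apply: leq_trans le_eb.
  by rewrite ltn_neqAle ne_je dvdn_leq.
apply: (mulIf (x := \prod_(j <- rem e (divisors e)) cycl F j)).
  by rewrite monic_neq0 // monic_prod // => j _; apply: cycl_monic.
have split_e (G : nat -> {poly F}) :
    G e * \prod_(j <- rem e (divisors e)) G j = \prod_(j <- divisors e) G j.
  by rewrite [RHS](big_rem e e_div).
by rewrite -{1}eq_rem !split_e -prodP // -cycl_prod.
Qed.

(* Main.v *)
Require Import Defs.
From mathcomp Require Import all_boot all_order all_algebra all_fingroup.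
From mathcomp Require Import all_solvable all_field zify ring.

(* With n = m d, every n-th root of unity z in an algebraic closure satisfies
   z ^ t = theta ^ u for exactly one pair (t, u) with t | m, 1 <= u <= d and
   gcd(u, t) = 1, which gives x^n - 1 = \prod_(t, u) (x^t - theta^u). Applying this
   to the primitive d-th root theta^-e and substituting x^e for x factors
   x^(en) - 1; the factorization of Phi_e(x^n) follows by induction over the
   divisors of e, since f |-> theta^(-u deg f) f(theta^u x^t) is multiplicative.
   For irreducibility, a root b of a divisor h of such a factor is fixed by the
   r-th power of Frobenius for some r <= deg h, since the powers b^(q^i) are all
   roots of h. Then deg f | r because f(theta^u b^t) = 0, and t | r by comparing
   the p-adic valuations of the order of b^e and of q^r - 1 (lifting the exponent).
   As t and deg f are coprime, deg h >= t deg f. *)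

Set Implicit Arguments.
Unset Strict Implicit.
Unset Printing Implicit Defensive.

Import GRing.Theory.
Local Open Scope ring_scope.

(** * Valuations of [q ^ r - 1]: lifting the exponent *)

(** Binomial theorem up to order two, kept in [nat]. With [y = q - 1] divisible by [p], the terms
    shown determine the valuations below. *)
Lemma expn1D_expansion (y k : nat) :
  exists c, ((1 + y) ^ k = 1 + y * (k + y * ('C(k, 2) + y * c)))%N.
Proof.
elim: k => [|k [c IHk]]; first by exists 0%N; rewrite bin0n !(muln0, addn0).
exists ('C(k, 2) + c + y * c)%N; rewrite expnS IHk binS bin1 -[k.+1]add1n.
by ring.
Qed.

(** The cofactor of [q - 1] in the expansion is congruent to [r] modulo [p], hence prime to [p]. *)
Lemma logn_expn_subn1_coprime (p q r : nat) : prime p -> (p %| q - 1)%N ->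
  (1 < q)%N -> ~~ (p %| r)%N -> logn p (q ^ r - 1) = logn p (q - 1).
Proof.
move=> p_pr p_dv q_gt1 p_ndv; have q_gt0 := ltnW q_gt1.
have [c] := expn1D_expansion (q - 1) r; rewrite subnKC // => ->.
rewrite addKn mulnC logn_Gauss // prime_coprime // addnC.
by rewrite dvdn_addr // dvdn_mulr.
Qed.

(** Writing [q - 1 = x * p], the cofactor is [p] times [1 + x * ('C(p, 2) + (q - 1) * c)]. The
    latter is prime to [p]: for odd [p] because [p] divides ['C(p, 2)], for [p = 2] because [q = 1]
    modulo 4 makes [x] even. *)
Lemma logn_expn_subn1_prime (p q : nat) : prime p -> (p %| q - 1)%N ->
  (1 < q)%N -> (p = 2 -> q = 1 %[mod 4])%N ->
  logn p (q ^ p - 1) = (logn p (q - 1)).+1.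
Proof.
move=> p_pr p_dv q_gt1 q_mod4; have q_gt0 := ltnW q_gt1.
have p_gt0 := prime_gt0 p_pr; have y_gt0 : (0 < q - 1)%N by rewrite subn_gt0.
have [c] := expn1D_expansion (q - 1) p; rewrite subnKC // => ->.
rewrite addKn; case/dvdnP: (p_dv) => x def_x.
rewrite [X in (p + X)%N](_ : _ = p * (x * ('C(p, 2) + (q - 1) * c)))%N; last first.
  by rewrite {1}def_x; ring.
rewrite -[X in (X + _)%N]muln1 -mulnDr mulnCA lognM ?muln_gt0 ?y_gt0 ?addn_gt0 //.
rewrite logn_prime // eqxx -[in RHS]add1n; congr (_ + _)%N.
rewrite mulnC logn_Gauss // prime_coprime //.
rewrite dvdn_addl ?Euclid_dvd1 // mulnDr dvdn_add //; last first.
  by rewrite mulnCA dvdn_mulr.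
have [p2 | p_gt2] := eqVneq p 2%N.
  rewrite dvdn_mulr //; have := q_mod4 p2.
  move/eqP; rewrite eq_sym eq_sym eqn_mod_dvd // def_x p2.
  by rewrite -[4%N]/(2 * 2)%N dvdn_pmul2r.
by rewrite dvdn_mull // prime_dvd_bin //= ltn_neqAle eq_sym p_gt2 prime_gt1.
Qed.

(** Induction stripping one factor [p] from [r = s * p] at a time: [q ^ s] inherits the hypotheses
    on [q]. *)
Lemma logn_expn_subn1 (p q r : nat) : prime p -> (p %| q - 1)%N ->
  (1 < q)%N -> (p = 2 -> q = 1 %[mod 4])%N -> (0 < r)%N ->
  logn p (q ^ r - 1) = (logn p (q - 1) + logn p r)%N.
Proof.
move=> p_pr p_dv q_gt1 q_mod4; have [b] := ubnP r; elim: b => // b IHb in r *.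
move=> /ltnSE le_rb r_gt0.
have [/dvdnP[s def_r] | p_ndv] := boolP (p %| r)%N; last first.
  by rewrite logn_expn_subn1_coprime // (lognE p r) (negPf p_ndv) !andbF addn0.
move: le_rb r_gt0; rewrite def_r muln_gt0 => le_sb /andP[s_gt0 p_gt0].
have lt_sb : (s < b)%N.
  by apply: leq_trans le_sb; rewrite -{1}(muln1 s) ltn_pmul2l ?prime_gt1.
have dv_s : (p %| q ^ s - 1)%N.
  by rewrite -(exp1n s) subn_exp dvdn_mulr.
rewrite expnM logn_expn_subn1_prime //.
- by rewrite IHb // lognM // (logn_prime p p_pr) eqxx addn1 addnS.
- by rewrite -(exp1n s) ltn_exp2r.
- by move=> p2; rewrite -modnXm q_mod4 // modnXm exp1n.
Qed.

(** * Roots of unity sorted by their powers lying in the group generated by [theta] *)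

(** Since [z ^+ t] is killed by [M = N / gcd(N, t)], [d] divides [u * M], so the valuation of [d] is
    at most that of [M]. It is positive, which forces the valuation of [gcd(N, t)] to be that of
    [t]. *)
Lemma prim_root_logn (R : nzRingType) (d t u N p : nat) (theta z : R) :
    d.-primitive_root theta -> z ^+ t = theta ^+ u -> z ^+ N = 1 ->
    (0 < N)%N -> (0 < t)%N -> prime p -> (p %| d)%N -> ~~ (p %| u)%N ->
  (logn p t + logn p d <= logn p N)%N.
Proof.
move=> prim_th ztu zN1 N_gt0 t_gt0 p_pr p_dv_d p_ndv_u.
have d_gt0 := prim_order_gt0 prim_th.
pose M := (N %/ gcdn N t)%N.
have g_gt0 : (0 < gcdn N t)%N by rewrite gcdn_gt0 N_gt0.
have M_gt0 : (0 < M)%N by rewrite divn_gt0 // dvdn_leq ?dvdn_gcdl.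
have: (d %| u * M)%N.
  rewrite (prim_order_dvd prim_th) exprM -ztu -exprM /M muln_divA ?dvdn_gcdl //.
  by rewrite mulnC -muln_divA ?dvdn_gcdr // exprM zN1 expr1n.
move/(dvdn_leq_log p) => /(_ _); rewrite muln_gt0 M_gt0 andbT.
case: (posnP u) p_ndv_u => [->|u_gt0]; first by rewrite dvdn0.
rewrite -(prime_coprime _ p_pr) => co_pu /(_ isT).
rewrite logn_Gauss // logn_div ?dvdn_gcdl // logn_gcd //.
have: (0 < logn p d)%N by rewrite logn_gt0 mem_primes p_pr d_gt0.
lia.
Qed.

Lemma coprime_prime_dvd (a b : nat) : (0 < a)%N ->
  (forall p, prime p -> (p %| a)%N -> (p %| b)%N -> False) -> coprime a b.
Proof.
move=> a_gt0 no_p; apply: contraT => gcd_neq1.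
have gcd_gt1 : (1 < gcdn a b)%N by rewrite ltn_neqAle eq_sym gcd_neq1 gcdn_gt0 a_gt0.
case: (no_p _ (pdiv_prime gcd_gt1)).
- exact: dvdn_trans (pdiv_dvd _) (dvdn_gcdl _ _).
- exact: dvdn_trans (pdiv_dvd _) (dvdn_gcdr _ _).
Qed.

Lemma monic_dvd_prod_XsubC (K : fieldType) (rs : seq K) (p : {poly K}) :
    uniq rs -> p \is monic -> p %| \prod_(z <- rs) ('X - z%:P) ->
  p = \prod_(z <- rs | root p z) ('X - z%:P).
Proof.
move=> rs_uniq p_monic /dvdp_prod_XsubC[b].
rewrite eqp_monic ?monic_prod_XsubC // => /eqP def_p.
rewrite [LHS]def_p -[RHS]big_filter; apply: perm_big.
apply: uniq_perm; rewrite ?mask_uniq ?filter_uniq // => z.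
rewrite mem_filter {1}def_p root_prod_XsubC.
by apply/idP/andP => [zb | []//]; rewrite zb (mem_mask zb).
Qed.

Section RootsOfUnity.

Variables (K : fieldType) (m d : nat) (theta : K).
Hypotheses (prim_th : d.-primitive_root theta) (m_gt0 : (0 < m)%N).
Hypothesis primes_m : forall p, prime p -> (p %| m)%N -> (p %| d)%N.

Let d_gt0 : (0 < d)%N. Proof. exact: prim_order_gt0 prim_th. Qed.

(* The exponent t is the order of z ^+ d. *)
Lemma unity_root_expr_exists (z : K) : z ^+ (m * d) = 1 ->
  exists t u, [/\ (t %| m)%N, (1 <= u <= d)%N, coprime u t & z ^+ t = theta ^+ u].
Proof.
move=> zmd; have zdm : (z ^+ d) ^+ m = 1 by rewrite -exprM mulnC.
have [t prim_zd t_dv_m] := prim_order_exists m_gt0 zdm.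
have t_gt0 := prim_order_gt0 prim_zd.
have ztd : (z ^+ t) ^+ d = 1 by rewrite -exprM mulnC exprM (prim_expr_order prim_zd).
have [u [u_d ztu]] : exists u, (1 <= u <= d)%N /\ z ^+ t = theta ^+ u.
  have [[u lt_ud] /= ztu] := prim_rootP prim_th ztd.
  (* Exponents run over 1..d, so the residue 0 is represented by [d]. *)
  have [u0 | u_gt0] := posnP u; last by exists u; rewrite u_gt0 ltnW.
  by exists d; rewrite d_gt0 leqnn ztu u0 (prim_expr_order prim_th).
exists t, u; split=> //; apply: coprime_prime_dvd => [|p p_pr p_u p_t].
  by case/andP: u_d.
have p_d : (p %| d)%N by rewrite primes_m // (dvdn_trans p_t).
(* If [p] divided both [t] and [u], then [(z ^+ d) ^+ (t / p) = theta ^+ (u * (d / p)) = 1], against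
   the order [t] of [z ^+ d]. *)
suff: (t %| t %/ p)%N.
  rewrite gtnNdvd ?ltn_Pdiv ?(prime_gt1 p_pr) //.
  by rewrite divn_gt0 ?(prime_gt0 p_pr) // dvdn_leq.
rewrite (prim_order_dvd prim_zd) -exprM mulnC divn_mulAC // -muln_divA //.
rewrite exprM ztu -exprM muln_divA // -divn_mulAC // mulnC exprM.
by rewrite (prim_expr_order prim_th) expr1n.
Qed.

(** Checked prime by prime: [z ^+ (t' * d) = 1], so [prim_root_logn] with [N = t' * d] bounds the
    valuation of [t * d] by that of [t' * d]. *)
Lemma unity_root_expr_dvdn (z : K) (t t' u u' : nat) :
    (0 < t)%N -> (t %| m)%N -> (0 < t')%N -> coprime u t ->
    z ^+ t = theta ^+ u -> z ^+ t' = theta ^+ u' ->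
  (t %| t')%N.
Proof.
move=> t_gt0 t_m t'_gt0 co_ut ztu zt'u'.
apply/dvdn_partP => // p; rewrite mem_primes => /and3P[p_pr _ p_t].
have p_d : (p %| d)%N by rewrite primes_m // (dvdn_trans p_t).
rewrite p_part pfactor_dvdn // -(leq_add2r (logn p d)) -(lognM p t'_gt0 d_gt0).
apply: (prim_root_logn prim_th ztu _ _ _ p_pr p_d) => //.
- by rewrite exprM zt'u' exprAC (prim_expr_order prim_th) expr1n.
- by rewrite muln_gt0 t'_gt0.
apply/negP => p_u; have: (p %| gcdn u t)%N by rewrite dvdn_gcd p_u.
by rewrite (eqP co_ut) Euclid_dvd1.
Qed.

Lemma unity_root_expr_inj (z : K) (t t' u u' : nat) :
    (t %| m)%N -> (t' %| m)%N -> (1 <= u <= d)%N -> (1 <= u' <= d)%N ->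
    coprime u t -> coprime u' t' ->
    z ^+ t = theta ^+ u -> z ^+ t' = theta ^+ u' ->
  t = t' /\ u = u'.
Proof.
move=> t_m t'_m u_d u'_d co_ut co_ut' ztu ztu'.
have t_gt0 := dvdn_gt0 m_gt0 t_m; have t'_gt0 := dvdn_gt0 m_gt0 t'_m.
have tt' : t = t'.
  apply/eqP; rewrite eqn_dvd (unity_root_expr_dvdn _ _ _ co_ut ztu ztu') //.
  exact: unity_root_expr_dvdn co_ut' ztu' ztu.
split=> //; move: ztu'; rewrite -tt' ztu => /eqP.
rewrite (eq_prim_root_expr prim_th) => /eqP.
case/andP: u_d u'_d => u_gt0 le_ud /andP[u'_gt0 le_u'd].
have [eq_d | lt_ud] := eqVneq u d; have [eq_d' | lt_u'd] := eqVneq u' d.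
- by rewrite eq_d eq_d'.
- rewrite eq_d modnn modn_small ?ltn_neqAle ?lt_u'd // => u'0.
  by rewrite -u'0 in u'_gt0.
- by rewrite eq_d' modnn modn_small ?ltn_neqAle ?lt_ud // => u0; rewrite u0 in u_gt0.
by rewrite !modn_small // ltn_neqAle ?lt_ud ?lt_u'd.
Qed.

Lemma prod_Xn_sub_expr_roots (rs : seq K) : uniq rs ->
    'X^(m * d) - 1 = \prod_(z <- rs) ('X - z%:P) ->
  'X^(m * d) - 1 = \prod_(t <- divisors m) \prod_(1 <= u < d.+1 | coprime u t)
                    ('X^t - (theta ^+ u)%:P).
Proof.
move=> rs_uniq def_rs; rewrite [LHS]def_rs.
have z_md z : z \in rs -> z ^+ (m * d) = 1.
  rewrite -root_prod_XsubC -def_rs rootE !hornerE subr_eq0.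
  by move/eqP.
(* The linear factors are grouped by the unique pair [(t, u)] attached to each root; a group
   multiplies to ['X^t - theta ^+ u] once this is known to divide ['X^(m * d) - 1]. *)
transitivity (\prod_(t <- divisors m) \prod_(1 <= u < d.+1 | coprime u t)
    \prod_(z <- rs | z ^+ t == theta ^+ u) ('X - z%:P)); last first.
  apply: eq_big_seq => t; rewrite -dvdn_divisors // => t_m.
  apply: eq_bigr => u _; have t_gt0 := dvdn_gt0 m_gt0 t_m.
  rewrite [RHS](monic_dvd_prod_XsubC rs_uniq) ?monicXnsubC // -?def_rs.
    by apply: eq_bigl => z; rewrite rootE !hornerE subr_eq0.
  (* With [m = s * t], the polynomial is [('X^t) ^+ (s * d) - (theta ^+ u) ^+ (s * d)], the
     subtracted power being 1. *)
  have [s ->] := dvdnP t_m.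
  have cX : (theta ^+ u)%:P ^+ (s * d) = 1 :> {poly K}.
    by rewrite -polyC_exp exprAC mulnC exprM (prim_expr_order prim_th) !expr1n.
  have -> : (s * t * d = t * (s * d))%N by ring.
  by rewrite exprM -cX subrXX dvdp_mulIl.
(* With the product over [z] moved outside, each [z] must contribute exactly one factor: existence
   and uniqueness of its pair. *)
under [RHS]eq_bigr => t _ do rewrite (exchange_big_dep predT) //=.
rewrite [RHS]exchange_big /=; apply: eq_big_seq => z /z_md zmd.
have [t [u [t_m u_d co_ut ztu]]] := unity_root_expr_exists zmd.
have t_div : t \in divisors m by rewrite -dvdn_divisors.
have u_iota : u \in index_iota 1 d.+1 by rewrite mem_index_iota.
rewrite [RHS](bigD1_seq t) ?divisors_uniq //= [X in X * _]big_mkcond.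
rewrite (bigD1_seq u) ?iota_uniq //= co_ut ztu eqxx.
rewrite !big1_seq ?mulr1 // => [t' /andP[ne_t' t'_div] | u' /andP[ne_u' u'_iota]].
  rewrite -dvdn_divisors // in t'_div.
  rewrite big_seq_cond big_pred0 // => u'; apply/and3P => -[].
  rewrite mem_index_iota ltnS => u'_d co_ut' /eqP zt'u'; case/eqP: ne_t'.
  by have [-> //] := unity_root_expr_inj t_m t'_div u_d u'_d co_ut co_ut' ztu zt'u'.
case: andP => // -[co_ut' /eqP th_uu']; rewrite mem_index_iota ltnS in u'_iota.
case/eqP: ne_u'.
have zt_u' := etrans ztu th_uu'.
by have [_ ->] := unity_root_expr_inj t_m t_m u_d u'_iota co_ut co_ut' ztu zt_u'.
Qed.

End RootsOfUnity.

Lemma separable_Xn_sub_1_roots (K : closedFieldType) (n : nat) : n%:R != 0 :> K ->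
  exists2 rs : seq K, uniq rs & 'X^n - 1 = \prod_(z <- rs) ('X - z%:P).
Proof.
move=> n_neq0; have [rs def_rs] := closed_field_poly_normal ('X^n - 1 : {poly K}).
have n_gt0 : (0 < n)%N by case: n n_neq0 {def_rs} => //; rewrite eqxx.
rewrite (monicP (monic_Xn_sub_1 _ n_gt0)) scale1r in def_rs.
by exists rs => //; rewrite -separable_prod_XsubC -def_rs separable_Xn_sub_1.
Qed.

(** The identity is proved in an algebraic closure, where ['X^(m * d) - 1] splits into distinct
    linear factors, and descends by injectivity. *)
Lemma prod_Xn_sub_expr (F : countFieldType) (m d : nat) (theta : F) :
    d.-primitive_root theta -> (m * d)%:R != 0 :> F ->
    (forall p, prime p -> (p %| m)%N -> (p %| d)%N) ->
  'X^(m * d) - 1 = \prod_(t <- divisors m) \prod_(1 <= u < d.+1 | coprime u t)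
                    ('X^t - (theta ^+ u)%:P).
Proof.
move=> prim_th md_neq0 primes_m.
have m_gt0 : (0 < m)%N by case: m md_neq0 {primes_m} => //; rewrite mul0n eqxx.
have [K [iota _]] := countable_algebraic_closure F.
have [|rs rs_uniq def_rs] := @separable_Xn_sub_1_roots K (m * d).
  by rewrite -(rmorph_nat iota) fmorph_eq0.
have prim_ith : d.-primitive_root (iota theta) by rewrite fmorph_primitive_root.
apply: (map_poly_inj iota).
rewrite rmorphB rmorph1 /= map_polyXn.
rewrite (prod_Xn_sub_expr_roots prim_ith m_gt0 primes_m rs_uniq def_rs).
rewrite rmorph_prod; apply: eq_bigr => t _; rewrite rmorph_prod; apply: eq_bigr => u _.
by rewrite rmorphB /= map_polyXn map_polyC /= (rmorphXn iota).
Qed.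

(** * The multiplicative operation sending [f] to its twisted substitution *)

Section Twist.

Variables (F : fieldType) (theta : F).

(** The scalar, in which [(size f).-1] is the degree, cancels the power of [theta] that the
    substitution brings into the leading coefficient: for [theta != 0] and [t > 0], monic
    polynomials stay monic. *)
Definition twist (t u : nat) (f : {poly F}) : {poly F} :=
  theta ^- (u * (size f).-1) *: (f \Po (theta ^+ u *: 'X^t)).

Lemma twist1 t u : twist t u 1 = 1.
Proof. by rewrite /twist size_poly1 muln0 expr0 invr1 scale1r rmorph1. Qed.

Lemma twistM t u f g : f != 0 -> g != 0 ->
  twist t u (f * g) = twist t u f * twist t u g.
Proof.
move=> f_neq0 g_neq0; rewrite /twist rmorphM /= -scalerAl -scalerAr scalerA.
have -> : (size (f * g)%R).-1 = ((size f).-1 + (size g).-1)%N.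
  move: f_neq0 g_neq0; rewrite -!size_poly_gt0 => f_gt0 g_gt0.
  rewrite size_mul -?size_poly_gt0 //; move: (size f) (size g) f_gt0 g_gt0; lia.
by rewrite mulnDr exprD invfM.
Qed.

Lemma twist_prod (I : eqType) (r : seq I) t u (f : I -> {poly F}) :
    (forall i, i \in r -> f i != 0) ->
  twist t u (\prod_(i <- r) f i) = \prod_(i <- r) twist t u (f i).
Proof.
elim: r => [|i r IHr] f_neq0; first by rewrite !big_nil twist1.
rewrite !big_cons twistM ?f_neq0 ?mem_head ?IHr // => [j j_r|].
  by rewrite f_neq0 // inE j_r orbT.
rewrite prodf_seq_neq0; apply/allP => j j_r /=.
by rewrite f_neq0 // inE j_r orbT.
Qed.

Lemma prod_twist_prod (I : eqType) (r : seq I) (m d : nat) (f : I -> {poly F}) :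
    (forall i, i \in r -> f i != 0) ->
  \prod_(t <- divisors m) \prod_(1 <= u < d.+1 | coprime u t)
      twist t u (\prod_(i <- r) f i)
  = \prod_(i <- r) \prod_(t <- divisors m) \prod_(1 <= u < d.+1 | coprime u t)
      twist t u (f i).
Proof.
move=> f_neq0; rewrite [RHS]exchange_big; apply: eq_bigr => t _ /=.
by rewrite [RHS]exchange_big; apply: eq_bigr => u _ /=; apply: twist_prod.
Qed.

Lemma twist_Xn_sub_1 t u e : theta != 0 -> (0 < e)%N ->
  twist t u ('X^e - 1) = 'X^(t * e) - (theta ^- (u * e))%:P.
Proof.
move=> theta_neq0 e_gt0; rewrite /twist size_Xn_sub_1 //= rmorphB rmorph1 /= comp_Xn_poly.
rewrite exprZn -exprM -exprM scalerBr scalerA mulVf ?expf_neq0 // scale1r.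
by rewrite -mul_polyC mulr1.
Qed.

End Twist.

(** * Frobenius periods of roots and degrees of irreducible polynomials *)

Section Frobenius.

Variables (F : finFieldType) (K : fieldType) (iota : {rmorphism F -> K}).
Local Notation q := #|F|.

Let q_gt1 : (1 < q)%N. Proof. exact: finNzRing_gt1. Qed.

Lemma pchar_nat_card : [pchar F].-nat q.
Proof.
have [p p_pr pcharFp] := finPcharP F.
by rewrite (card_pprimeChar pcharFp) pnatX pnatE // pcharFp.
Qed.

Lemma pchar_nat_card_exp i : [pchar K].-nat (q ^ i)%N.
Proof.
by rewrite pnatX (eq_pnat _ (fmorph_pchar iota)) pchar_nat_card.
Qed.

Let exprq0 i : 0 ^+ (q ^ i) = 0 :> K.
Proof. by rewrite expr0n expn_eq0 gtn_eqF ?(ltnW q_gt1). Qed.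

Lemma frobenius_inj i : injective (fun x : K => x ^+ (q ^ i)).
Proof.
move=> x y /= /eqP; rewrite -subr_eq0 -exprNn_pchar ?pchar_nat_card_exp //.
rewrite -exprDn_pchar ?pchar_nat_card_exp //.
by rewrite expf_eq0 subr_eq0 => /andP[_ /eqP].
Qed.

Lemma horner_map_frobenius (h : {poly F}) (b : K) i :
  (map_poly iota h).[b ^+ (q ^ i)] = (map_poly iota h).[b] ^+ (q ^ i).
Proof.
elim/poly_ind: h => [|h c IHh]; first by rewrite rmorph0 !horner0 exprq0.
rewrite rmorphD rmorphM /= map_polyX map_polyC /= !hornerMXaddC IHh.
rewrite exprDn_pchar ?pchar_nat_card_exp // exprMn -(rmorphXn iota); congr (_ + iota _).
by elim: i {IHh} => [|i IHi]; rewrite ?expr1 // expnSr exprM -IHi expf_card.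
Qed.

(** Pigeonhole: [size h] Frobenius iterates of [b] are all roots of [h], one more than its degree
    allows. Two of them coincide, and injectivity of Frobenius cancels the smaller exponent. *)
Lemma root_frobenius_period (h : {poly F}) (b : K) : h != 0 ->
    root (map_poly iota h) b ->
  exists r, (0 < r < size h)%N /\ b ^+ (q ^ r) = b.
Proof.
move=> h_neq0 hb; pose s := [seq b ^+ (q ^ i) | i <- seq.iota 0 (size h)].
have: ~~ uniq s.
  apply/negP => s_uniq; have := @max_poly_roots _ (map_poly iota h) s.
  rewrite map_poly_eq0 h_neq0 s_uniq size_map_poly size_map size_iota ltnn.
  suff -> : all (root (map_poly iota h)) s by move/(_ isT isT isT).
  apply/allP => _ /mapP[i _ ->].
  by rewrite rootE horner_map_frobenius (rootP hb) exprq0.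
case/(uniqPn 0) => i [j []]; rewrite size_map size_iota => lt_ij lt_jh.
rewrite !(nth_map 0%N) ?size_iota ?(ltn_trans lt_ij) // !nth_iota ?(ltn_trans lt_ij) //.
rewrite !add0n -{1}(subnK (ltnW lt_ij)) expnD exprM => /frobenius_inj b_r.
exists (j - i)%N; rewrite subn_gt0 lt_ij; split=> //.
exact: leq_ltn_trans (leq_subr _ _) lt_jh.
Qed.

(** The [q ^ n] values at [a] of polynomials of degree below [n = deg f] are distinct by
    irreducibility, and all are roots of ['X^(q ^ s) - 'X]. *)
Lemma irreducible_size_le_period (f : {poly F}) (a : K) s : irreducible_poly f ->
    root (map_poly iota f) a -> (0 < s)%N -> a ^+ (q ^ s) = a ->
  ((size f).-1 <= s)%N.
Proof.
move=> f_irr fa s_gt0 a_s; set n := (size f).-1.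
have f_neq0 := irredp_neq0 f_irr.
pose ev (v : 'rV[F]_n) := (map_poly iota (rVpoly v)).[a].
have ev_inj : injective ev.
  move=> v w /eqP; rewrite -subr_eq0 -hornerN -hornerD -!rmorphB /= -linearB => ev_vw.
  apply/eqP; rewrite -subr_eq0 -(can_eq rVpolyK) linear0; apply: contraT => vw_neq0.
  have := (subfx_irreducibleP fa f_neq0).2 f_irr _ ev_vw vw_neq0.
  rewrite leqNgt (leq_ltn_trans (size_poly _ _)) // prednK ?leqnn //.
  by rewrite size_poly_gt0.
have q_s : (1 < q ^ s)%N by rewrite -(expn0 q) ltn_exp2l.
pose g : {poly K} := 'X^(q ^ s) - 'X.
have size_g : size g = (q ^ s).+1.
  by rewrite size_polyDl ?size_polyN size_polyXn ?size_polyX.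
have g_neq0 : g != 0 by rewrite -size_poly_eq0 size_g.
have := @max_poly_roots _ g (codom ev) g_neq0 _ _.
rewrite size_g size_codom card_mx mul1n ltnS leq_exp2l //; apply.
  apply/allP => _ /codomP[v ->].
  by rewrite rootE !hornerE -horner_map_frobenius a_s subrr.
by rewrite map_inj_uniq ?enum_uniq.
Qed.

(** The two preceding bounds make [deg f] itself a period of [a]. The remainder of [r] modulo it is
    then a period below the minimum, hence 0. *)
Lemma irreducible_size_dvdn_period (f : {poly F}) (a : K) r : irreducible_poly f ->
    root (map_poly iota f) a -> (0 < r)%N -> a ^+ (q ^ r) = a ->
  ((size f).-1 %| r)%N.
Proof.
move=> f_irr fa r_gt0 a_r; have f_neq0 := irredp_neq0 f_irr.
have [s [/andP[s_gt0 lt_sf] a_s]] := root_frobenius_period f_neq0 fa.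
have def_s : s = (size f).-1.
  apply/eqP; rewrite eqn_leq (irreducible_size_le_period f_irr fa) // andbT.
  by rewrite -ltnS prednK // size_poly_gt0.
have a_sx x : a ^+ (q ^ (x * s)) = a.
  by elim: x => // x IHx; rewrite mulSn expnD exprM a_s IHx.
rewrite -def_s /dvdn -leqn0 leqNgt; apply/negP => rs_gt0.
have := irreducible_size_le_period f_irr fa rs_gt0.
rewrite -def_s leqNgt ltn_pmod //= => /(_ _)/negP; apply=> //.
by rewrite -{2}a_r {2}(divn_eq r s) expnD exprM a_sx.
Qed.

End Frobenius.

(** * Cyclotomic polynomials over a finite field *)

Lemma natr_neq0_coprime_card (F : finFieldType) (a : nat) : coprime a #|F| ->
  a%:R != 0 :> F.
Proof.
move=> co_a; have q_gt1 := finNzRing_gt1 F.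
have [p p_pr pcharFp] := finPcharP F; rewrite -(dvdn_pcharf pcharFp).
have p_q : (p %| #|F|)%N.
  have pi_q : pdiv #|F| \in \pi(#|F|%N) by rewrite pi_pdiv.
  have := pnatPpi (pchar_nat_card F) pi_q.
  by rewrite (pcharf_eq pcharFp) inE => /eqP <-; apply: pdiv_dvd.
apply/negP => p_a; have: (p %| gcdn a #|F|)%N by rewrite dvdn_gcd p_a.
by rewrite (eqP co_a) Euclid_dvd1.
Qed.

Lemma prim_rootV (K : fieldType) n (x : K) : n.-primitive_root x ->
  n.-primitive_root x^-1.
Proof.
move=> prim_x; have n_gt0 := prim_order_gt0 prim_x.
have xn1 := prim_expr_order prim_x; have x_neq0 : x != 0.
  by apply: contra_eq_neq xn1 => ->; rewrite expr0n gtn_eqF // eq_sym oner_neq0.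
have -> : x^-1 = x ^+ n.-1.
  by apply: (mulIf x_neq0); rewrite mulVf // -exprSr prednK.
by rewrite prim_root_exp_coprime // -{2}(prednK n_gt0) coprimenS.
Qed.

(** If the order [o] of [a] were a proper divisor of [e], [a] would also be a root of some
    [cycl F j] with [j] dividing [o], hence a double root of the separable polynomial ['X^e - 1]. *)
Lemma root_cycl_prim (F : finFieldType) (K : fieldType)
    (iota : {rmorphism F -> K}) e (a : K) : (0 < e)%N -> coprime e #|F| ->
  root (map_poly iota (cycl F e)) a -> e.-primitive_root a.
Proof.
move=> e_gt0 co_eq ra.
have e_div : e \in divisors e by rewrite -dvdn_divisors.
have Xe := cycl_prod F e_gt0; rewrite (bigD1_seq e) ?divisors_uniq //= in Xe.
have: separable_poly ('X^e - 1 : {poly F}).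
  by rewrite separable_Xn_sub_1 // natr_neq0_coprime_card.
rewrite Xe separable_mul => /and3P[_ _]; rewrite -(coprimep_map iota) => co_rest.
have ae1 : a ^+ e = 1.
  apply/eqP; rewrite -subr_eq0.
  have := congr1 (fun p => (map_poly iota p).[a]) Xe.
  rewrite rmorphM rmorphB rmorph1 /= map_polyXn hornerM (rootP ra) mul0r.
  by rewrite !hornerE => ->.
have [o prim_a o_e] := prim_order_exists e_gt0 ae1.
have o_gt0 := prim_order_gt0 prim_a.
have [<- // | ne_oe] := eqVneq o e; case/negP: (coprimep_root co_rest ra).
have := congr1 (fun p => (map_poly iota p).[a]) (cycl_prod F o_gt0).
rewrite rmorphB rmorph1 /= map_polyXn !hornerE (prim_expr_order prim_a) subrr.
rewrite !rmorph_prod /= !horner_prod => /esym/eqP; rewrite !prodf_seq_eq0.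
case/hasP => j; rewrite -dvdn_divisors // => j_o /= cj; apply/hasP; exists j.
  by rewrite -dvdn_divisors // (dvdn_trans j_o).
rewrite cj andbT; apply: contraNneq ne_oe => ej.
by rewrite eqn_dvd o_e -ej.
Qed.

Lemma irreducible_size_dvdn_ord_mod (F : finFieldType) (K : fieldType)
    (iota : {rmorphism F -> K}) e (f : {poly F}) (a : K) :
    (0 < e)%N -> coprime e #|F| -> irreducible_poly f ->
    root (map_poly iota f) a -> a ^+ e = 1 ->
  ((size f).-1 %| ord_mod e #|F|)%N.
Proof.
move=> e_gt0 co_eq f_irr fa ae1; apply: (irreducible_size_dvdn_period f_irr fa) => //.
by rewrite -(expr_mod _ ae1) expn_ord_mod // expr_mod // expr1.
Qed.

(** A root [a] is a primitive [e]-th root of unity, so its Frobenius periods are the [r] with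
    [q ^ r = 1] modulo [e]. Some positive period is at most [deg f], while [deg f] divides the
    period [ord_mod e q]. *)
Lemma irreducible_dvd_cycl_size (F : finFieldType) e (f : {poly F}) :
    (0 < e)%N -> coprime e #|F| -> irreducible_poly f -> f %| cycl F e ->
  (size f).-1 = ord_mod e #|F|.
Proof.
move=> e_gt0 co_eq f_irr f_dvd; have f_neq0 := irredp_neq0 f_irr.
have [K [iota _]] := countable_algebraic_closure F.
have [a fa] : exists a, root (map_poly iota f) a.
  by apply/closed_rootP; rewrite size_map_poly gtn_eqF //; case: f_irr.
have prim_a : e.-primitive_root a.
  apply: (@root_cycl_prim _ _ iota) => //.
  by rewrite (root_dvdp _ fa) ?dvdp_map.
apply/eqP; rewrite eqn_leq; apply/andP; split.
  apply: dvdn_leq (ord_mod_gt0 _ _) _.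
  exact: (irreducible_size_dvdn_ord_mod e_gt0 co_eq f_irr fa (prim_expr_order prim_a)).
have [r [/andP[r_gt0 lt_rf] a_r]] := root_frobenius_period f_neq0 fa.
have le_rf : (r <= (size f).-1)%N by rewrite -ltnS prednK // size_poly_gt0.
apply: leq_trans le_rf; apply: ord_mod_min => //.
by apply/eqP; rewrite -(eq_prim_root_expr prim_a) a_r.
Qed.

(* When [q = 3 %[mod 4]] and [p = 2], lifting the exponent fails for even [r], but then
   [2 %| r] already suffices because [4] does not divide [t]. *)
Lemma dvdn_of_logn_expn_subn1 (q n t r : nat) :
    (1 < q)%N -> (0 < n)%N -> (0 < r)%N ->
    (forall p, prime p -> (p %| n)%N -> (p %| q - 1)%N) ->
    ((8 %| n)%N -> (q = 1 %[mod 4])%N) ->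
    (t %| n %/ gcdn n (q - 1))%N ->
    (forall p, prime p -> (p %| t)%N ->
       (logn p t + logn p (gcdn n (q - 1)) <= logn p (q ^ r - 1))%N) ->
  (t %| r)%N.
Proof.
move=> q_gt1 n_gt0 r_gt0 primes_n q_mod4 t_m le_t.
set d := gcdn n (q - 1) in t_m le_t *.
have d_n : (d %| n)%N := dvdn_gcdl _ _.
have m_gt0 : (0 < n %/ d)%N by rewrite divn_gt0 ?(dvdn_gt0 n_gt0 d_n) // dvdn_leq.
have t_gt0 := dvdn_gt0 m_gt0 t_m.
have q1_gt0 : (0 < q - 1)%N by rewrite subn_gt0.
apply/dvdn_partP => // p; rewrite mem_primes => /and3P[p_pr _ p_t].
have p_n : (p %| n)%N.
  by rewrite (dvdn_trans p_t) // (dvdn_trans t_m) // dvdn_div.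
have p_q1 := primes_n p p_pr p_n.
have t_gt0p : (0 < logn p t)%N by rewrite logn_gt0 mem_primes p_pr t_gt0.
have q1_gt0p : (0 < logn p (q - 1))%N by rewrite logn_gt0 mem_primes p_pr q1_gt0.
have le_tm : (logn p t <= logn p n - logn p d)%N.
  by rewrite -logn_div // dvdn_leq_log.
have def_d : logn p d = minn (logn p n) (logn p (q - 1)) by rewrite logn_gcd.
have := le_t p p_pr p_t; rewrite p_part pfactor_dvdn //.
have LTE : (p = 2 -> q = 1 %[mod 4])%N ->
    logn p (q ^ r - 1) = (logn p (q - 1) + logn p r)%N.
  by move=> ?; apply: logn_expn_subn1.
have [/implyP p2_mod4 | not_mod4] := boolP ((p == 2) ==> (q == 1 %[mod 4]))%N.
  (* As [p] divides [t], [d] has smaller valuation than [n], hence the valuation of [q - 1]; it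
     cancels on both sides. *)
  rewrite LTE => [|/eqP/p2_mod4/eqP //]; move: le_tm def_d t_gt0p.
  move: (logn p t) (logn p d) (logn p n) (logn p (q - 1)) (logn p r).
  clear; lia.
move: not_mod4; rewrite negb_imply => /andP[/eqP p2 /eqP q_3].
have n_lt3 : (logn p n < 3)%N.
  rewrite ltnNge; apply/negP => n_ge3; apply/q_3/q_mod4.
  by rewrite -[8%N]/(2 ^ 3)%N pfactor_dvdn //; rewrite p2 in n_ge3.
have [p_r | p_ndv] := boolP (p %| r)%N.
  have: (0 < logn p r)%N by rewrite logn_gt0 mem_primes p_pr r_gt0.
  move: le_tm def_d t_gt0p n_lt3 q1_gt0p.
  move: (logn p t) (logn p d) (logn p n) (logn p (q - 1)) (logn p r) (logn p (q ^ r - 1)).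
  clear; lia.
(* This case is contradictory: [d] again has the valuation of [q - 1], which for odd [r] is that of
   [q ^ r - 1], leaving no room for the factor 2 of [t]. *)
rewrite logn_expn_subn1_coprime //; move: le_tm def_d t_gt0p.
move: (logn p t) (logn p d) (logn p n) (logn p (q - 1)) (logn p r).
clear; lia.
Qed.

(** * Irreducibility of the twisted polynomials *)

Lemma size_twist (F : fieldType) (theta : F) t u (f : {poly F}) :
  theta != 0 -> (0 < t)%N -> (size (twist theta t u f)).-1 = ((size f).-1 * t)%N.
Proof.
move=> th_neq0 t_gt0; rewrite size_scale ?invr_eq0 ?expf_neq0 // size_comp_poly.
by rewrite size_scale ?expf_neq0 // size_polyXn.
Qed.

(** Taking [f] to divide ['X^e - 1] serves both factorizations. Then [deg f] divides [ord_mod e q],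
    which suffices for its coprimality with [t]. *)
Lemma twist_irreducible (F : finFieldType) (e n t u : nat) (theta : F) (f : {poly F}) :
    let q := #|F| in let d := gcdn n (q - 1) in
    (0 < e)%N -> coprime e q -> (0 < n)%N ->
    (forall p, prime p -> (p %| n)%N -> (p %| q - 1)%N) ->
    coprime n (ord_mod e q * e) -> ((8 %| n)%N -> (q = 1 %[mod 4])%N) ->
    d.-primitive_root theta -> irreducible_poly f -> f %| 'X^e - 1 ->
    (t %| n %/ d)%N -> coprime u t ->
  irreducible_poly (twist theta t u f).
Proof.
move=> q d e_gt0 co_eq n_gt0 primes_n co_n q_mod4 prim_th f_irr f_dvd t_m co_ut.
have q_gt1 : (1 < q)%N := finNzRing_gt1 F.
have d_n : (d %| n)%N := dvdn_gcdl _ _.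
have d_gt0 := prim_order_gt0 prim_th.
have m_gt0 : (0 < n %/ d)%N by rewrite divn_gt0 // dvdn_leq.
have t_gt0 := dvdn_gt0 m_gt0 t_m.
have t_n : (t %| n)%N by rewrite (dvdn_trans t_m) // dvdn_div.
have [f_size _] := f_irr; have f_neq0 := irredp_neq0 f_irr.
have th_neq0 : theta != 0.
  apply: contra_eq_neq (prim_expr_order prim_th) => ->.
  by rewrite expr0n gtn_eqF // eq_sym oner_neq0.
set g := twist theta t u f.
have size_g : (size g).-1 = ((size f).-1 * t)%N by apply: size_twist.
have g_size : (1 < size g)%N.
  have: (0 < (size g).-1)%N by rewrite size_g muln_gt0 t_gt0 andbT -ltnS prednK // ltnW.
  by case: (size g) => [|[]].
split=> // h h_size h_g.
have g_neq0 : g != 0 by rewrite -size_poly_gt0 ltnW.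
have h_neq0 : h != 0 by apply: contraNneq g_neq0 => h0; rewrite -dvd0p -h0.
rewrite -dvdp_size_eqp // eqn_leq dvdp_leq //=.
have [K [iota _]] := countable_algebraic_closure F.
have [b hb] : exists b, root (map_poly iota h) b.
  by apply/closed_rootP; rewrite size_map_poly.
have [r [/andP[r_gt0 lt_rh] b_r]] := root_frobenius_period h_neq0 hb.
pose a := iota theta ^+ u * b ^+ t.
have def_a : a = (map_poly iota (theta ^+ u *: 'X^t)).[b].
  by rewrite map_polyZ /= map_polyXn rmorphXn !hornerE.
have fa : root (map_poly iota f) a.
  have: root (map_poly iota g) b by apply: root_dvdp _ hb; rewrite dvdp_map.
  rewrite /g /twist map_polyZ /= map_comp_poly /=.
  rewrite rootZ ?fmorph_eq0 ?invr_eq0 ?expf_neq0 //.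
  by rewrite !rootE horner_comp -def_a.
have a_r : a ^+ (q ^ r) = a by rewrite def_a -horner_map_frobenius b_r.
have ae1 : a ^+ e = 1.
  have: root (map_poly iota ('X^e - 1)) a by apply: root_dvdp _ fa; rewrite dvdp_map.
  by rewrite rmorphB rmorph1 /= map_polyXn rootE !hornerE subr_eq0 => /eqP.
have b_neq0 : b != 0.
  apply: contra_eq_neq ae1; rewrite /a => ->.
  by rewrite expr0n gtn_eqF // mulr0 expr0n gtn_eqF // eq_sym oner_neq0.
have b_qr1 : b ^+ (q ^ r - 1) = 1.
  apply: (mulIf b_neq0); rewrite mul1r -exprSr subn1 prednK ?b_r //.
  by rewrite expn_gt0 ltnW.
have qr_gt0 : (0 < q ^ r - 1)%N by rewrite subn_gt0 -(expn0 q) ltn_exp2l.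
move: co_n; rewrite coprimeMr => /andP[co_nk co_ne].
have prim_ithV : d.-primitive_root (iota theta)^-1.
  by rewrite prim_rootV // fmorph_primitive_root.
have t_r : (t %| r)%N.
  apply: (dvdn_of_logn_expn_subn1 q_gt1 n_gt0) => // p p_pr p_t.
  have p_n := dvdn_trans p_t t_n.
  (* From [a ^+ e = 1] comes [(b ^+ e) ^+ t = theta ^- (u * e)]. A prime [p] dividing [t] divides
     neither [u] nor [e], the latter being coprime to [n]. *)
  apply: (@prim_root_logn _ d t (u * e) _ p (iota theta)^-1 (b ^+ e)) => //.
  - rewrite -exprM mulnC exprM exprVn; apply: (mulrI (x := iota theta ^+ (u * e))).
      by rewrite unitfE expf_neq0 // fmorph_eq0.
    by rewrite mulfV ?expf_neq0 ?fmorph_eq0 // exprM -exprMn.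
  - by rewrite exprAC b_qr1 expr1n.
  - by rewrite dvdn_gcd p_n primes_n.
  rewrite Euclid_dvdM // negb_or -!prime_coprime // (coprime_dvdl p_n co_ne) andbT.
  by rewrite coprime_sym (coprime_dvdr p_t).
have deg_k : ((size f).-1 %| ord_mod e q)%N.
  exact: (irreducible_size_dvdn_ord_mod e_gt0 co_eq f_irr fa ae1).
have : ((size f).-1 * t %| r)%N.
  rewrite Gauss_dvd ?(irreducible_size_dvdn_period f_irr fa) // coprime_sym.
  exact: coprime_dvdl t_n (coprime_dvdr deg_k co_nk).
move/(dvdn_leq r_gt0); rewrite -size_g => le_gr.
by rewrite -(prednK (ltnW g_size)) (leq_ltn_trans le_gr).
Qed.

(** * Product formulas for ['X^(e * n) - 1] and the cyclotomic polynomial at ['X^n] *)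

Section TwistedFactorization.

Variables (F : finFieldType) (n : nat) (theta : F).
Local Notation q := #|F|.
Local Notation d := (gcdn n (q - 1)).
Hypothesis n_gt0 : (0 < n)%N.
Hypothesis primes_n : forall p, prime p -> (p %| n)%N -> (p %| q - 1)%N.
Hypothesis prim_th : d.-primitive_root theta.

Let theta_neq0 : theta != 0.
Proof.
apply: contra_eq_neq (prim_expr_order prim_th) => ->.
by rewrite expr0n gtn_eqF ?(prim_order_gt0 prim_th) // eq_sym oner_neq0.
Qed.

Lemma Xn_sub_1_prod_twist e : (0 < e)%N -> coprime n e ->
  'X^(e * n) - 1 = \prod_(t <- divisors (n %/ d))
    \prod_(1 <= u < d.+1 | coprime u t) twist theta t u ('X^e - 1).
Proof.
move=> e_gt0 co_ne; have q_gt1 := finNzRing_gt1 F.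
have def_n : n = (n %/ d * d)%N by rewrite divnK ?dvdn_gcdl.
(* This root is chosen because [twist] turns ['X^e - 1] into ['X^(t * e) - theta ^- (u * e)]; it
   stays primitive since [d] divides [n], which is coprime to [e]. *)
have prim_thVe : d.-primitive_root (theta^-1 ^+ e).
  rewrite prim_root_exp_coprime ?prim_rootV // coprime_sym.
  exact: coprime_dvdl (dvdn_gcdl _ _) co_ne.
have n_neq0 : (n %/ d * d)%:R != 0 :> F.
  (* A prime dividing both [n] and [q] would divide [q - 1] and [q]. *)
  rewrite -def_n natr_neq0_coprime_card // coprime_prime_dvd // => p p_pr p_n p_q.
  have := primes_n p_pr p_n; rewrite dvdn_subr ?(ltnW q_gt1) // Euclid_dvd1 //.
have primes_m p : prime p -> (p %| n %/ d)%N -> (p %| d)%N.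
  move=> p_pr p_m; have p_n : (p %| n)%N.
    by rewrite (dvdn_trans p_m) // dvdn_div ?dvdn_gcdl.
  by rewrite dvdn_gcd p_n primes_n.
have := congr1 (fun p => p \Po 'X^e) (prod_Xn_sub_expr prim_thVe n_neq0 primes_m).
rewrite -def_n rmorphB rmorph1 /= comp_Xn_poly -exprM => ->.
rewrite rmorph_prod; apply: eq_bigr => t _; rewrite rmorph_prod; apply: eq_bigr => u _.
rewrite rmorphB /= comp_Xn_poly comp_polyC twist_Xn_sub_1 //.
by rewrite -exprM -[in RHS]exprVn -exprM (mulnC e t) (mulnC e u).
Qed.

Lemma cycl_comp_Xn_prod_twist e : (0 < e)%N -> coprime n e ->
  cycl F e \Po 'X^n = \prod_(t <- divisors (n %/ d))
    \prod_(1 <= u < d.+1 | coprime u t) twist theta t u (cycl F e).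
Proof.
have m_gt0 : (0 < n %/ d)%N.
  by rewrite divn_gt0 ?(prim_order_gt0 prim_th) // dvdn_leq ?dvdn_gcdl.
have [b] := ubnP e; elim: b e => // b IHb e /ltnSE le_eb e_gt0 co_ne.
have e_div : e \in divisors e by rewrite -dvdn_divisors.
pose G j := \prod_(t <- divisors (n %/ d))
  \prod_(1 <= u < d.+1 | coprime u t) twist theta t u (cycl F j).
(* Both products equal ['X^(e * n) - 1]. The induction hypothesis identifies the factors of proper
   divisors, which are nonzero and cancel. *)
have: \prod_(j <- divisors e) (cycl F j \Po 'X^n) = \prod_(j <- divisors e) G j.
  rewrite -prod_twist_prod => [|j _]; last by rewrite monic_neq0 ?cycl_monic.
  rewrite -cycl_prod // -Xn_sub_1_prod_twist // -[LHS]rmorph_prod -cycl_prod //=.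
  by rewrite rmorphB rmorph1 /= comp_Xn_poly -exprM mulnC.
rewrite -/(G e) !(bigD1_seq e) ?divisors_uniq //=.
have -> : \prod_(j <- divisors e | j != e) (cycl F j \Po 'X^n)
        = \prod_(j <- divisors e | j != e) G j.
  rewrite big_seq_cond [RHS]big_seq_cond; apply: eq_bigr => j.
  rewrite -dvdn_divisors // => /andP[j_e ne_je]; apply: IHb.
  - by apply: leq_trans le_eb; rewrite ltn_neqAle ne_je dvdn_leq.
  - exact: dvdn_gt0 e_gt0 j_e.
  exact: coprime_dvdr j_e co_ne.
apply: mulIf; rewrite prodf_seq_neq0; apply/allP => j _; apply/implyP => _.
rewrite prodf_seq_neq0; apply/allP => t; rewrite -dvdn_divisors // => t_m.
rewrite prodf_seq_neq0; apply/allP => u _; apply/implyP => _.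
rewrite scaler_eq0 negb_or invr_eq0 !expf_neq0 //=.
rewrite comp_poly_eq0 ?monic_neq0 ?cycl_monic //.
by rewrite size_scale ?expf_neq0 // size_polyXn ltnS (dvdn_gt0 m_gt0 t_m).
Qed.

End TwistedFactorization.
Theorem theorem2p7 (F : finFieldType) (q : nat) (card_F : #|F| = q)
    (e : nat) (e_gt0 : (0 < e)%N) (co_eq : coprime e q)
    (n : nat) (n_gt0 : (0 < n)%N)
    (primes_n : forall p : nat, prime p -> (p %| n)%N -> (p %| q - 1)%N)
    (co_n : coprime n (ord_mod e q * e))
    (q_mod4 : (8 %| n)%N -> (q = 1 %[mod 4])%N)
    (theta : F) (ord_theta : (gcdn n (q - 1)).-primitive_root theta) :
  let k := ord_mod e q in
  let l := (totient e %/ k)%N in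
  let d := gcdn n (q - 1) in
  let m := (n %/ d)%N in
  (forall f : 'I_l -> {poly F},
     (forall i, f i \is monic) ->
     (forall i, irreducible_poly (f i)) ->
     cycl F e = \prod_(i < l) f i ->
     cycl F e \Po 'X^n =
       \prod_(i < l) \prod_(t <- divisors m)
         \prod_(1 <= u < d.+1 | coprime u t)
           (theta ^- (u * k) *: (f i \Po (theta ^+ u *: 'X^t)))
     /\ (forall (i : 'I_l) (t u : nat), (t %| m)%N -> (1 <= u <= d)%N ->
           coprime u t ->
           irreducible_poly (theta ^- (u * k) *: (f i \Po (theta ^+ u *: 'X^t)))))
  /\
  (forall (N : nat) (f : 'I_N -> {poly F}),
     (forall i, f i \is monic) ->
     (forall i, irreducible_poly (f i)) ->
     'X^e - 1 = \prod_(i < N) f i ->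
     'X^(e * n) - 1 =
       \prod_(i < N) \prod_(t <- divisors m)
         \prod_(1 <= u < d.+1 | coprime u t)
           (theta ^- (u * (size (f i)).-1) *: (f i \Po (theta ^+ u *: 'X^t)))
     /\ (forall (i : 'I_N) (t u : nat), (t %| m)%N -> (1 <= u <= d)%N ->
           coprime u t ->
           irreducible_poly
             (theta ^- (u * (size (f i)).-1) *: (f i \Po (theta ^+ u *: 'X^t))))).
Proof.
subst q => k l d m.
have /andP[_ co_ne] : coprime n k && coprime n e by rewrite -coprimeMr.
have irr f t u : irreducible_poly f -> f %| 'X^e - 1 -> (t %| m)%N -> coprime u t ->
    irreducible_poly (twist theta t u f).
  by move=> f_irr f_dvd; apply: twist_irreducible f_irr f_dvd.
split=> [f f_monic f_irr def_cycl | N f f_monic f_irr def_Xe].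
  have f_cycl i : f i %| cycl F e by rewrite def_cycl (bigD1 i) //= dvdp_mulr.
  (* Every irreducible factor of [cycl F e] has degree [k], so the exponent in [twist] is
     [u * k]. *)
  have twist_f i t u : twist theta t u (f i) =
      theta ^- (u * k) *: (f i \Po (theta ^+ u *: 'X^t)).
    by rewrite /twist (irreducible_dvd_cycl_size e_gt0 co_eq (f_irr i) (f_cycl i)).
  split=> [|i t u t_m _ co_ut].
    rewrite (cycl_comp_Xn_prod_twist n_gt0 primes_n ord_theta) // def_cycl.
    rewrite prod_twist_prod => [|i _]; last exact: monic_neq0.
    apply: eq_bigr => i _; apply: eq_bigr => t _; apply: eq_bigr => u _.
    exact: twist_f.
  rewrite -twist_f; apply: irr => //; apply: dvdp_trans (f_cycl i) _.
  by rewrite cycl_prod // (big_rem e) ?dvdp_mulr // -dvdn_divisors.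
split=> [|i t u t_m _ co_ut].
  rewrite (Xn_sub_1_prod_twist n_gt0 primes_n ord_theta) // def_Xe.
  by rewrite prod_twist_prod => [|i _] //; apply: monic_neq0.
by apply: irr => //; rewrite def_Xe (bigD1 i) //= dvdp_mulr.
Qed.
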